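(* In the annotation model, any protocol for verifying single-source or all-pairs shortest paths on graph streams with $n$ nodes requires help cost times verification cost $=\Omega(n^2)$ bits. Additionally, if edge weights may be specified incrementally, then any protocol for minimum spanning tree requires help cost times verification cost $=\Omega(n^2)$ bits.
   Context: Annotation model: a data stream $\mathcal{A}$ of length $m$ is observed by a probabilistic verifier $\mathcal{V}$ (private random string, $w(m)$ machine words of working memory) and a deterministic helper $\mathcal{H}$. After the stream ends, $\mathcal{H}$ sends an annotation that $\mathcal{V}$ reads as a stream. $\mathcal{V}$ outputs a value (or accepts) or outputs $\perp$. A helper is valid for $\mathcal{A}$ if $\mathcal{V}$ outputs the correct answer with probability 1; it is $\tfrac13$-invalid for $\mathcal{A}$ if $\mathcal{V}$ outputs something other than $\perp$ with probability at most $1/3$. A protocol is valid if some helper is valid for every $\mathcal{A}$, and for every helper and every stream, the helper is either valid or $\tfrac13$-invalid. Help cost: maximum annotation length of a shortest valid helper; verification cost: $w(m)$; the lower bound on their product is measured in bits. Weighted graph stream: items $(u,v,w)\in[n]\times[n]\times\mathbb{Z}_+$. ''Edge weights specified incrementally'' means an edge may appear several times in the stream, its weight being the sum of the weights of its occurrences.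
   Formalization: A help cost of zero is counted as one word in the product, since a verifier that stores the whole stream needs no annotation and would make the literal product zero; for help cost at least one word the claim is as stated. *)

(* Defs.v *)
From HB Require Import structures.
From mathcomp Require Import all_boot all_order all_algebra.
From mathcomp Require Import boolp.

Set Implicit Arguments.
Unset Strict Implicit.
Unset Printing Implicit Defensive.

Import Order.TTheory GRing.Theory Num.Theory.
Local Open Scope ring_scope.

Definition word (b : nat) := b.-tuple bool.

(* A computational problem on streams of [item]s.  An answer is a sequence of
   output symbols; [correct] is a relation because an answer need not be
   unique (its order of presentation, the choice of a spanning tree). *)
Record problem (item osym : Type) := Problem {
  admissible : seq item -> Prop;
  correct : seq item -> seq osym -> Prop }.

(* A verifier with [w] words of [b] bits of working memory and unrestricted
   access to a random string drawn from a finite probability space.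
   Answers such as a table of distances are in general longer than the working
   memory, so they go to a write-only output tape that is not charged for:
   the verifier may append symbols while it parses the annotation, and when it
   halts it either outputs bottom ([None]) or appends a last block of symbols
   and outputs the content of the tape. *)
Record verifier (R : realFieldType) (item osym : Type) (b w : nat) := Verifier {
  rnd : finType;
  rnd_pr : rnd -> R;
  rnd_pr_ge0 : forall r, 0 <= rnd_pr r;
  rnd_pr_sum1 : \sum_r rnd_pr r = 1;
  init : rnd -> w.-tuple (word b);
  read : rnd -> w.-tuple (word b) -> item -> w.-tuple (word b);
  parse : rnd -> w.-tuple (word b) -> word b -> w.-tuple (word b) * seq osym;
  halt : rnd -> w.-tuple (word b) -> option (seq osym) }.

Section Model.
Variables (R : realFieldType) (item osym : Type) (b w : nat).
Variables (V : verifier R item osym b w) (X : problem item osym).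
Implicit Types (r : rnd V) (A : seq item) (H : seq item -> seq (word b)).

Definition parse_step r (c : w.-tuple (word b) * seq osym) (a : word b) :=
  let: (q, o) := parse r c.1 a in (q, c.2 ++ o).

Definition output r A (ann : seq (word b)) : option (seq osym) :=
  let q := foldl (read r) (init r) A in
  let c := foldl (parse_step r) (q, [::]) ann in
  omap (cat c.2) (halt r c.1).

Definition Pr (E : rnd V -> Prop) : R := \sum_(r | `[< E r >]) rnd_pr r.

(* A (deterministic) helper is the function sending a stream to its
   annotation. *)
Definition valid_for H A : Prop :=
  Pr (fun r => exists2 o, output r A (H A) = Some o & correct X A o) = 1.

Definition invalid_for (delta : R) H A : Prop :=
  Pr (fun r => output r A (H A) <> None) <= delta.

Definition valid_helper H : Prop := forall A, admissible X A -> valid_for H A.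

Definition valid_protocol : Prop :=
  (exists H, valid_helper H) /\
  (forall H A, admissible X A -> valid_for H A \/ invalid_for 3^-1 H A).

(* [h], counted in words, is the maximum annotation length of a shortest valid
   helper. *)
Definition help_cost (h : nat) : Prop :=
  exists H,
    [/\ valid_helper H,
        forall H' A, valid_helper H' -> admissible X A ->
          (size (H A) <= size (H' A))%N,
        forall A, admissible X A -> (size (H A) <= h)%N
      & exists2 A, admissible X A & size (H A) = h].

End Model.

(* Help cost times verification cost, both in bits, is at least [c * n ^ 2] for
   every protocol for [X].  A protocol without any help has product 0 whatever
   its memory (store the stream and solve the problem), so a help cost of zero
   is counted as one word. *)
Definition requires_product (item osym : Type) (c : rat) (n : nat)
    (X : problem item osym) : Prop :=
  forall (R : realFieldType) (b w h : nat) (V : verifier R item osym b w),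
    (0 < b)%N -> valid_protocol V X -> help_cost V X h ->
    c * (n ^ 2)%:R <= ((maxn 1 h * b) * (w * b))%:R.

Section Graphs.
Variable n : nat.

(* The item (u, v, x) gives (additional) weight x to the undirected edge uv. *)
Definition gitem := ('I_n * 'I_n * nat)%type.
Implicit Types (A : seq gitem) (u v : 'I_n) (T : {set {set 'I_n}}).

Definition edge_of (x : gitem) : {set 'I_n} := [set x.1.1; x.1.2].

Definition edges A : {set {set 'I_n}} := [set:: [seq edge_of x | x <- A]].

Definition weight A (e : {set 'I_n}) : nat :=
  (\sum_(x <- A | edge_of x == e) x.2)%N.

Definition adj T : rel 'I_n := [rel u v | [set u; v] \in T].

Definition connected T : Prop := forall u v, connect (adj T) u v.

(* Without a bound on the weights no protocol of finite cost exists, since a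
   fixed memory and annotation length allow only finitely many answers. *)
Definition incremental_stream (m wmax : nat) A : Prop :=
  (size A <= m)%N /\
  (forall x, x \in A -> x.1.1 != x.1.2 /\ (0 < x.2 <= wmax)%N).

Definition simple_stream (m wmax : nat) A : Prop :=
  incremental_stream m wmax A /\ uniq [seq edge_of x | x <- A].

Definition walk A u v (p : seq 'I_n) : Prop :=
  path (adj (edges A)) u p /\ last u p = v.

Definition walk_length A u (p : seq 'I_n) : nat :=
  sumn (pairmap (fun x y => weight A [set x; y]) u p).

Definition is_dist A u v (d : option nat) : Prop :=
  if d is Some l then
    (exists2 p, walk A u v p & walk_length A u p = l) /\
    (forall p, walk A u v p -> (l <= walk_length A u p)%N)
  else forall p, ~ walk A u v p.

Definition sssp (m wmax : nat) (s : 'I_n) : problem gitem ('I_n * option nat) :=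
  Problem (simple_stream m wmax)
    (fun A o => forall v d, (v, d) \in o <-> is_dist A s v d).

Definition apsp (m wmax : nat) : problem gitem ('I_n * 'I_n * option nat) :=
  Problem (simple_stream m wmax)
    (fun A o => forall u v d, (u, v, d) \in o <-> is_dist A u v d).

Definition acyclic T : Prop :=
  forall c : seq 'I_n, ucycle (adj T) c -> (size c <= 2)%N.

Definition spanning_tree A T : Prop :=
  [/\ T \subset edges A, connected T & acyclic T].

Definition min_spanning_tree A T : Prop :=
  spanning_tree A T /\
  (forall T', spanning_tree A T' ->
     (\sum_(e in T) weight A e <= \sum_(e in T') weight A e)%N).

Definition mst_incremental (m wmax : nat) : problem gitem {set 'I_n} :=
  Problem (fun A => incremental_stream m wmax A /\ connected (edges A))
    (fun A o => min_spanning_tree A [set:: o]).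

End Graphs.

(* Main.v *)
(* The lower bound comes from the one-way communication problem INDEX on k^2
   bits, k ~ n/2.  Alice's bits are the edges of a bipartite graph, and a short
   suffix of the stream, chosen by Bob, forces any correct answer to reveal the
   bit of his choice: adding an edge from s to l i makes r j be at distance 2
   from s if and only if l i -- r j is present, and for spanning trees Bob makes
   all other edges at r j heavy.
   To remove the helper, Alice sends the memory states of O(help cost)
   independent copies of the verifier, and Bob looks for an annotation on which
   no copy outputs bottom.  An invalid annotation survives with probability at
   most 3^-K, which beats the number of annotations, so with high probability
   Bob only sees valid ones.  Counting Hamming balls shows that INDEX requires a
   linear message. *)
Require Import Defs.
From HB Require Import structures.
From mathcomp Require Import all_boot all_order all_algebra.
From mathcomp Require Import boolp zify.

Set Implicit Arguments.
Unset Strict Implicit.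
Unset Printing Implicit Defensive.

Import Order.TTheory GRing.Theory Num.Theory.
Local Open Scope ring_scope.

(** * Lossy codes *)

Definition hdist (I : finType) (x y : {ffun I -> bool}) : nat :=
  #|[pred i | x i != y i]|.

(** The sum factors over coordinates: each one contributes 4 for the value agreeing with [y] and 1
    for the other. *)
Lemma sum_exp_hdist (I : finType) (y : {ffun I -> bool}) :
  (\sum_x 4 ^ (#|I| - hdist x y) = 5 ^ #|I|)%N.
Proof.
transitivity (\prod_(i : I) \sum_(a : bool) if a == y i then 4 else 1)%N.
  rewrite bigA_distr_bigA; apply: eq_bigr => x _.
  rewrite -big_mkcond /= prod_nat_const; congr (4 ^ _)%N.
  have := cardC [pred i | x i != y i].
  rewrite /hdist => <-; rewrite addKn; apply: eq_card => i.
  by rewrite !inE negbK.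
transitivity (\prod_(i : I) 5)%N; last by rewrite prod_nat_const.
by apply: eq_bigr => i _; rewrite big_bool /=; case: (y i).
Qed.

(** Chernoff-style estimate: every point of the ball contributes at least [4 ^ (#|I| - t)] to the
    sum [5 ^ #|I|]. *)
Lemma card_hamming_ball (I : finType) (y : {ffun I -> bool}) t :
  (#|[pred x | hdist x y <= t]| * 4 ^ (#|I| - t) <= 5 ^ #|I|)%N.
Proof.
rewrite -(sum_exp_hdist y) -sum_nat_const.
rewrite [leqRHS](bigID [pred x | hdist x y <= t]%N) /=.
apply: leq_trans (leq_addr _ _).
by apply: leq_sum => x xy; rewrite leq_exp2l // leq_sub2l.
Qed.

(** Splitting by the message [q = f x], the well-decoded words lie in one ball around each [g q]. *)
Lemma card_near_decoded (I Q : finType) (f : {ffun I -> bool} -> Q)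
    (g : Q -> {ffun I -> bool}) t :
  (#|[pred x | hdist x (g (f x)) <= t]| * 4 ^ (#|I| - t) <= #|Q| * 5 ^ #|I|)%N.
Proof.
have -> : (#|[pred x | hdist x (g (f x)) <= t]| =
    \sum_q #|[pred x | (hdist x (g (f x)) <= t) && (f x == q)]|)%N.
  rewrite -sum1_card (partition_big f predT) //=.
  by apply: eq_bigr => q _; rewrite -sum1_card; apply: eq_bigl => x; rewrite inE.
rewrite big_distrl /= -sum_nat_const; apply: leq_sum => q _.
apply: leq_trans (card_hamming_ball (g q) t); rewrite leq_mul2r.
apply/orP; right; apply: subset_leq_card; apply/subsetP => x.
by rewrite !inE => /andP[+ /eqP <-].
Qed.

Lemma lossy_code_bound (I Q : finType) (f : {ffun I -> bool} -> Q)
    (g : Q -> {ffun I -> bool}) s :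
  (20 * \sum_x hdist x (g (f x)) <= #|I| * 2 ^ #|I|)%N -> (#|Q| <= 2 ^ s)%N ->
  (14 * #|I| <= 30 * s + 30)%N.
Proof.
move=> avg cardQ; set N := #|I| in avg *.
pose t := (N %/ 10)%N.
have near := card_near_decoded f g t; rewrite -/N in near.
have : (2 ^ N <= 2 * #|[pred x | hdist x (g (f x)) <= t]|)%N.
  have := cardC [pred x | hdist x (g (f x)) <= t]%N.
  rewrite card_ffun card_bool -/N.
  set G := #|_|; set B := #|_| => GB.
  (* Markov's inequality: a word outside the radius [t] has at least [t.+1] errors, and [10 * t.+1]
     exceeds [N]. The factor [N.+1] can be cancelled even if [N = 0]. *)
  have : (B * N.+1 <= 10 * \sum_x hdist x (g (f x)))%N.
    rewrite -sum_nat_const big_distrr /=.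
    rewrite [leqRHS](bigID [pred x | hdist x (g (f x)) <= t]%N) /=.
    apply: leq_trans (leq_addl _ _); apply: leq_sum => x.
    by rewrite !inE /t; lia.
  move: (2 ^ N)%N (\sum_x _)%N avg GB => P D avg GB BD.
  have : (2 * B * N.+1 <= P * N.+1)%N.
    rewrite -mulnA; have : (P * N <= P * N.+1)%N by rewrite leq_mul2l leqnSn orbT.
    lia.
  by rewrite leq_pmul2r //; lia.
set G := #|_| in near * => half.
have : (2 ^ N * 4 ^ (N - t) <= 2 ^ s.+1 * 5 ^ N)%N.
  apply: (@leq_trans (2 * G * 4 ^ (N - t))); first by rewrite leq_mul2r half orbT.
  rewrite expnS -!mulnA leq_mul2l /=; apply: leq_trans near _.
  by rewrite leq_mul2r cardQ orbT.
(* After cubing, [5 ^ 3 = 125 <= 128 = 2 ^ 7] turns everything into powers of 2. *)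
rewrite -(@leq_exp2r _ _ 3) // !expnMn -!expnM.
rewrite -[(4 ^ _)%N]/((2 ^ 2) ^ _)%N -expnM -expnD => bound.
have : (2 ^ (N * 3 + 2 * ((N - t) * 3)) <= 2 ^ (s.+1 * 3 + 7 * N))%N.
  apply: leq_trans bound _; rewrite expnD leq_mul2l; apply/orP; right.
  rewrite mulnC expnM (expnM 2 7).
  by case: (posnP N) => [->|N_gt0] //; rewrite leq_exp2r.
rewrite leq_exp2l // /t; clearbody N; clear; lia.
Qed.

(** * Removing the helper *)

Section Amplification.
Variables (R : realFieldType) (item osym : Type) (b w : nat).
Variables (V : verifier R item osym b w).

Definition resume (r : rnd V) q (A : seq item) (ann : seq (word b)) :
    option (seq osym) :=
  let c := foldl (parse_step r) (foldl (read r) q A, [::]) ann in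
  omap (cat c.2) (halt r c.1).

Lemma output_cat (r : rnd V) (A B : seq item) ann :
  output r (A ++ B) ann = resume r (foldl (read r) (init r) A) B ann.
Proof. by rewrite /output foldl_cat. Qed.

(** The complement of [E] has total mass 0 and its terms are nonnegative, so each of them
    vanishes. *)
Lemma Pr1_ae (E : rnd V -> Prop) r : Pr E = 1 -> rnd_pr r != 0 -> E r.
Proof.
move=> PE; apply: contra_neqP => nEr.
have := rnd_pr_sum1 V; rewrite (bigID (fun r => `[< E r >])) /= -/(Pr E) PE.
move/eqP; rewrite -subr_eq0 addrAC subrr add0r => /eqP /psumr_eq0P -> //.
  by move=> *; apply: rnd_pr_ge0.
by apply/asboolPn.
Qed.

Variable K : nat.
Implicit Types rho : {ffun 'I_K -> rnd V}.

Definition copies_pr rho : R := \prod_k rnd_pr (rho k).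

Lemma copies_pr_ge0 rho : 0 <= copies_pr rho.
Proof. by apply: prodr_ge0 => k _; apply: rnd_pr_ge0. Qed.

Lemma copies_pr_sum1 : \sum_rho copies_pr rho = 1.
Proof.
transitivity (\prod_(k < K) \sum_r @rnd_pr _ _ _ _ _ V r); last first.
  by rewrite big1 // => k _; apply: rnd_pr_sum1.
by rewrite bigA_distr_bigA.
Qed.

Lemma copies_pr_all (E : pred (rnd V)) :
  \sum_(rho : {ffun 'I_K -> rnd V} | [forall k, E (rho k)]) copies_pr rho =
  (\sum_(r | E r) rnd_pr r) ^+ K.
Proof.
rewrite -[K in RHS]card_ord -prodr_const bigA_distr_big.
apply: eq_bigl => rho; apply/forallP/ffun_onP => H k; exact: H.
Qed.

(* Every list of at most [h] words is [take i t] for some pair [(i, t)]. *)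
Definition annot h (a : 'I_h.+1 * h.-tuple (word b)) : seq (word b) :=
  take a.1 a.2.

Lemma annot_surj h (s : seq (word b)) : (size s <= h)%N ->
  exists a : 'I_h.+1 * h.-tuple (word b), annot a = s.
Proof.
move=> sh; have size_pad : size (s ++ nseq (h - size s) [tuple of nseq b true]) == h.
  by rewrite size_cat size_nseq subnKC.
exists (Ordinal (n := h.+1) (m := size s) sh, Tuple size_pad).
by rewrite /annot /= take_size_cat.
Qed.

Definition accepted rho (q : 'I_K -> w.-tuple (word b)) B ann :=
  [forall k, isSome (resume (rho k) (q k) B ann)].

Definition alice A rho : {ffun 'I_K -> w.-tuple (word b)} :=
  [ffun k => foldl (read (rho k)) (init (rho k)) A].

(** [D] is the property of an answer that reveals a one. Bob trusts any annotation that no copy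
    rejects and reads the answer from copy [k0]; the final [false] is a default. *)
Definition bob h (k0 : 'I_K) (B : seq item) (D : seq osym -> Prop) rho
    (q : {ffun 'I_K -> w.-tuple (word b)}) : bool :=
  if [pick a : 'I_h.+1 * h.-tuple (word b) | accepted rho q B (annot a)] is Some a
  then `[< exists2 o, resume (rho k0) (q k0) B (annot a) = Some o & D o >]
  else false.

Lemma accepted_alice A B rho ann :
  accepted rho (alice A rho) B ann = [forall k, isSome (output (rho k) (A ++ B) ann)].
Proof. by apply: eq_forallb => k; rewrite ffunE output_cat. Qed.

(** The annotation of the valid helper passes all copies, so the search succeeds. Whatever it finds
    is not invalid, hence valid, and a valid annotation gives a correct answer on every random
    string of nonzero mass. *)
Lemma bob_correct (X : problem item osym) h k0 A B D rho (H : seq item -> seq (word b))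
    (x : bool) :
  valid_protocol V X -> admissible X (A ++ B) ->
  valid_for V X H (A ++ B) -> (size (H (A ++ B)) <= h)%N ->
  (forall o, correct X (A ++ B) o -> (D o <-> x)) ->
  copies_pr rho != 0 ->
  (forall a : 'I_h.+1 * h.-tuple (word b),
    invalid_for V 3^-1 (fun=> annot a) (A ++ B) ->
    ~~ accepted rho (alice A rho) B (annot a)) ->
  @bob h k0 B D rho (alice A rho) = x.
Proof.
move=> [_ VP] adm vH sH DP; rewrite prodf_seq_neq0 => /allP rho_gt0 noinv.
have ae (E : rnd V -> Prop) k : Pr E = 1 -> E (rho k).
  by move=> PE; apply: Pr1_ae PE _; apply: rho_gt0; rewrite mem_index_enum.
rewrite /bob; case: pickP => [a acc | none]; last first.
  have [a Ha] := annot_surj sH.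
  have := none a; rewrite accepted_alice Ha => /negP[]; apply/forallP => k.
  by have [o ->] := ae _ k vH.
(* The dichotomy of the protocol is applied to the helper that sends this fixed annotation on every
   stream. *)
have va : valid_for V X (fun=> annot a) (A ++ B).
  case: (VP (fun=> annot a) _ adm) => // /noinv; by rewrite acc.
have [o ro co] := ae _ k0 va; rewrite ffunE -output_cat ro.
have Dx := DP o co.
by apply/asboolP/idP => [[_ [<-]]|xT]; [rewrite Dx | exists o; rewrite ?Dx].
Qed.

(** Union bound over the pairs encoding annotations; by independence an invalid annotation passes
    all [K] copies with probability at most [3^-1 ^+ K]. *)
Lemma bob_error (X : problem item osym) h k0 A B D (H : seq item -> seq (word b))
    (x : bool) :
  valid_protocol V X -> admissible X (A ++ B) ->
  valid_for V X H (A ++ B) -> (size (H (A ++ B)) <= h)%N ->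
  (forall o, correct X (A ++ B) o -> (D o <-> x)) ->
  \sum_(rho | @bob h k0 B D rho (alice A rho) != x) copies_pr rho <=
    (h.+1 * (2 ^ b) ^ h)%:R * 3^-1 ^+ K.
Proof.
move=> VP adm vH sH DP.
pose inv (a : 'I_h.+1 * h.-tuple (word b)) :=
  `[< invalid_for V 3^-1 (fun=> annot a) (A ++ B) >].
pose acc rho a := accepted rho (alice A rho) B (@annot h a).
apply: (@le_trans _ _ (\sum_rho \sum_(a | inv a && acc rho a) copies_pr rho)).
  rewrite big_mkcond; apply: ler_sum => rho _.
  case: ifP => [bobN|_]; last by apply: sumr_ge0 => a _; apply: copies_pr_ge0.
  have [-> | pr_neq0] := eqVneq (copies_pr rho) 0.
    by rewrite big1.
  have [a ia | none] := pickP (fun a => inv a && acc rho a).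
    rewrite (bigD1 a) //= lerDl; apply: sumr_ge0 => *; exact: copies_pr_ge0.
  case/eqP: bobN; apply: bob_correct VP adm vH sH DP pr_neq0 _ => a ia.
  by apply/negP => acca; have /negP[] := none a; rewrite /acc acca andbT; apply/asboolP.
rewrite (exchange_big_dep inv) /=; last by move=> rho a _ /andP[].
apply: (@le_trans _ _ (\sum_(a | inv a) 3^-1 ^+ K)); last first.
  rewrite big_mkcond /=.
  apply: (@le_trans _ _ (\sum_(a : 'I_h.+1 * h.-tuple (word b)) 3^-1 ^+ K)).
    apply: ler_sum => a _; case: ifP => // _; apply: exprn_ge0.
    by rewrite invr_ge0 ler0n.
  rewrite sumr_const card_prod card_ord !card_tuple card_bool.
  by rewrite -[leLHS]mulr_natl.
apply: ler_sum => a /asboolP ia.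
under eq_bigl => rho do rewrite /acc /inv accepted_alice (asboolT ia) /=.
rewrite (copies_pr_all (fun r => isSome (output r (A ++ B) (annot a)))).
apply: lerXn2r; rewrite ?nnegrE ?invr_ge0 ?ler0n //.
  by apply: sumr_ge0 => r _; apply: rnd_pr_ge0.
apply: le_trans ia; rewrite /Pr le_eqVlt; apply/orP; left; apply/eqP.
apply: eq_bigl => r; case: (output r _ _) => [o|].
  by rewrite asboolT.
by apply/esym/asboolPn; apply.
Qed.

End Amplification.

(** * The lower bound for INDEX *)

Lemma exists_le_average (R : realFieldType) (T : finType) (p : T -> R)
    (F : T -> nat) (c : nat) :
  (forall t, 0 <= p t) -> \sum_t p t = 1 -> \sum_t p t * (F t)%:R <= c%:R ->
  exists t, (F t <= c)%N.
Proof.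
move=> p_ge0 p1 avg; apply/existsP; apply: contraLR avg => /existsPn noF.
rewrite -ltNge; apply: (@lt_le_trans _ _ c.+1%:R); first by rewrite ltr_nat.
have -> : c.+1%:R = \sum_t p t * c.+1%:R by rewrite -big_distrl /= p1 mul1r.
apply: ler_sum => t _; apply: ler_wpM2l => //.
by rewrite ler_nat ltnNge; apply: noF.
Qed.

(** With [M = maxn 1 h * b], the left side is at most [(20 * 2 * 2) ^ M = 80 ^ M], below [243 ^ M].
    The maximum with 1 ensures [M > 0], which absorbs the factor 20. *)
Lemma annotations_lt_exp3 b h :
  (0 < b -> 20 * (h.+1 * (2 ^ b) ^ h) <= 3 ^ (5 * (maxn 1 h * b)))%N.
Proof.
move=> b_gt0; set M := (maxn 1 h * b)%N.
have M_gt0 : (0 < M)%N by rewrite muln_gt0 b_gt0 leq_max.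
have hM : (h * b <= M)%N by rewrite leq_mul2r leq_maxr orbT.
have hbM : (h <= M)%N by apply: leq_trans hM; rewrite leq_pmulr.
have h2 : (h.+1 <= 2 ^ M)%N.
  by apply: leq_trans (ltn_expl h (isT : 1 < 2)%N) _; rewrite leq_exp2l.
have b2 : ((2 ^ b) ^ h <= 2 ^ M)%N by rewrite -expnM leq_exp2l // mulnC.
apply: (@leq_trans (20 ^ M * (2 ^ M * 2 ^ M))).
  apply: leq_mul (leq_mul h2 b2); rewrite -[leqLHS]expn1; exact: leq_pexp2l.
by rewrite -!expnMn expnM leq_exp2r.
Qed.

(** Fixing good random strings makes Alice's states a deterministic lossy code of [K * (w * b)] bits
    for [x], with Bob's guesses as decoder. *)
Lemma index_lower_bound (R : realFieldType) (item osym : Type) (b w h : nat)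
    (V : verifier R item osym b w) (X : problem item osym) (I : finType)
    (pre : {ffun I -> bool} -> seq item) (suf : I -> seq item)
    (D : I -> seq osym -> Prop) :
  (0 < b)%N -> valid_protocol V X -> help_cost V X h ->
  (forall x i, admissible X (pre x ++ suf i)) ->
  (forall x i o, correct X (pre x ++ suf i) o -> (D i o <-> x i)) ->
  (14 * #|I| <= 150 * ((maxn 1 h * b) * (w * b)) + 30)%N.
Proof.
move=> b_gt0 VP [H [vH _ sH _]] adm DP.
set M := (maxn 1 h * b)%N; pose K := (5 * M)%N.
have K_gt0 : (0 < K)%N by rewrite !muln_gt0 b_gt0 leq_max.
pose k0 := Ordinal K_gt0.
pose guess rho x i := bob h k0 (suf i) (D i) rho (@alice _ _ _ _ _ V K (pre x) rho).
pose errors rho := (\sum_x \sum_i (guess rho x i != x i))%N.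
(* Each bit is guessed wrongly with probability at most 1/20, so some fixed choice of strings does
   no worse on average over all [x] and [i]. *)
have [rho few] : exists rho, (20 * errors rho <= #|I| * 2 ^ #|I|)%N.
  apply: (exists_le_average (p := @copies_pr _ _ _ _ _ V K)).
  - exact: copies_pr_ge0.
  - exact: copies_pr_sum1.
  under eq_bigr => rho _.
    rewrite natrM mulrCA natr_sum mulr_sumr.
    under eq_bigr => x _ do rewrite natr_sum mulr_sumr.
    over.
  rewrite -mulr_sumr exchange_big /=.
  under eq_bigr => x _ do rewrite exchange_big /=.
  rewrite mulr_sumr natrM mulrC.
  apply: (@le_trans _ _ (\sum_(x : {ffun I -> bool}) #|I|%:R)); last first.
    by rewrite sumr_const card_ffun card_bool -[leLHS]mulr_natr mulrC.
  apply: ler_sum => x _; rewrite mulr_sumr.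
  apply: (@le_trans _ _ (\sum_(i : I) 1)); last by rewrite sumr_const.
  apply: ler_sum => i _.
  have := bob_error k0 VP (adm x i) (vH _ (adm x i)) (sH _ (adm x i)) (DP x i).
  rewrite big_mkcond /= => err_le.
  apply: (@le_trans _ _ (20 * ((h.+1 * (2 ^ b) ^ h)%:R * 3^-1 ^+ K))).
    rewrite ler_wpM2l ?ler0n //; apply: le_trans err_le; apply: ler_sum => rho _.
    by rewrite /guess; case: ifP => _; rewrite ?mulr1 ?mulr0.
  rewrite mulrA -natrM exprVn ler_pdivrMr ?exprn_gt0 ?ltr0n // mul1r -natrX ler_nat.
  exact: annotations_lt_exp3.
have := @lossy_code_bound I {ffun 'I_K -> w.-tuple (word b)}
  (fun x => alice (pre x) rho) (fun q => [ffun i => bob h k0 (suf i) (D i) rho q])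
  (K * (w * b)).
rewrite (_ : 150 * _ = 30 * (K * (w * b)))%N; last by rewrite /K !mulnA.
apply.
  apply: leq_trans few; rewrite leq_mul2l /=; apply: leq_sum => x _.
  rewrite /hdist -sum1_card big_mkcond /=; apply: leq_sum => i _.
  by rewrite inE ffunE eq_sym /guess; case: (_ == _).
by rewrite card_ffun card_ord !card_tuple card_bool -!expnM leq_exp2l //; lia.
Qed.

(** * Graph streams *)

Lemma set2_inj (T : finType) (a b c d : T) :
  [set a; b] = [set c; d] -> (a = c /\ b = d) \/ (a = d /\ b = c).
Proof.
move=> E.
have /set2P ac : a \in [set c; d] by rewrite -E set21.
have /set2P bc : b \in [set c; d] by rewrite -E set22.
have /set2P ca : c \in [set a; b] by rewrite E set21.
have /set2P da : d \in [set a; b] by rewrite E set22.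
by intuition congruence.
Qed.

Lemma edges_cat n (A B : seq (gitem n)) : edges (A ++ B) = edges A :|: edges B.
Proof. by apply/setP => e; rewrite !inE map_cat mem_cat. Qed.

Lemma edgesP n (A : seq (gitem n)) e :
  reflect (exists2 x, x \in A & e = edge_of x) (e \in edges A).
Proof. by rewrite inE; apply: mapP. Qed.

Lemma weight_gt0 n (A : seq (gitem n)) e :
  (forall x, x \in A -> (0 < x.2)%N) -> e \in edges A -> (0 < weight A e)%N.
Proof.
move=> A_gt0 /edgesP[x xA ->]; rewrite /weight (big_rem x) //= eqxx.
by rewrite addn_gt0 A_gt0.
Qed.

Lemma weight_unit n (A : seq (gitem n)) e :
  (forall x, x \in A -> x.2 = 1%N) -> weight A e = count_mem e (map (@edge_of n) A).
Proof.
move=> A1; rewrite count_map -sum1_count /weight big_seq_cond [RHS]big_seq_cond.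
by apply: eq_bigr => x /andP[/A1].
Qed.

Lemma size_le_walk_length n (A : seq (gitem n)) u p :
  (forall x, x \in A -> (0 < x.2)%N) -> path (adj (edges A)) u p ->
  (size p <= walk_length A u p)%N.
Proof.
move=> A_gt0; rewrite /walk_length; elim: p u => //= v p IH u /andP[uv vp].
by rewrite -add1n leq_add ?IH // weight_gt0.
Qed.

Lemma adj_sym n (T : {set {set 'I_n}}) : symmetric (adj T).
Proof. by move=> u v; rewrite /adj /= setUC. Qed.

(** A vertex set [S] is grown from one point: while it is not everything, some edge leaves it, and
    adding the far endpoint puts that new edge inside [S]. *)
Lemma connected_card n (T : {set {set 'I_n}}) : connected T -> (n <= #|T|.+1)%N.
Proof.
case: n T => // n T conT.
suff grow m : (m <= n)%N ->
    exists2 S : {set 'I_n.+1}, #|S| = m.+1 & (m <= #|[set e in T | e \subset S]|)%N.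
  have [S _ leT] := grow n (leqnn n); apply: leq_trans leT _.
  by apply/subset_leq_card/subsetP => e; rewrite inE => /andP[].
elim: m => [|m IH] mn; first by exists [set ord0]; rewrite ?cards1.
have [S cardS leT] := IH (ltnW mn).
have [u [v [uS vS uv]]] : exists u v, [/\ u \in S, v \notin S & adj T u v].
  apply: contrapT => nocross.
  have clS : closed (adj T) (mem S).
    apply: intro_closed; first exact: sym_connect_sym (@adj_sym _ T).
    move=> x y xy xS.
    by apply: contrapT => /negP yS; apply: nocross; exists x, y.
  have [u uS] : exists u, u \in S by apply/set0Pn; rewrite -card_gt0 cardS.
  have : S = setT.
    by apply/setP => v; rewrite inE -(closed_connect clS (conT u v)).
  move=> ST; move: cardS; rewrite ST cardsT card_ord; lia.
exists (v |: S); first by rewrite cardsU1 vS cardS.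
apply: (leq_ltn_trans leT); apply: proper_card; apply/properP; split.
  apply/subsetP => e; rewrite !inE => /andP[-> eS] /=.
  exact: subset_trans eS (subsetUr _ _).
exists [set u; v].
  by rewrite inE [_ \in T]uv; apply/subsetP => z /set2P[] ->; rewrite !inE ?uS ?eqxx ?orbT.
by rewrite inE; apply/negP => /andP[_ /subsetP /(_ v)]; rewrite set22 (negPf vS) => /(_ isT).
Qed.

(* A vertex of maximal rank on a cycle has its parent as both neighbours. *)
Lemma parent_acyclic n (T : {set {set 'I_n}}) (par : 'I_n -> 'I_n) (rank : 'I_n -> nat) :
  (forall u v, adj T u v -> (rank u <= rank v)%N -> u = par v) -> acyclic T.
Proof.
move=> parP c; rewrite leqNgt => cyc; apply/negP => size_c.
have [v0 v0c] : exists v, v \in c by case: c {cyc} size_c => // v c; exists v; rewrite mem_head.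
case: (arg_maxnP rank v0c) => v vc v_max.
have [i c' Ec] := rot_to vc.
have cyc' : ucycle (adj T) (v :: c') by rewrite -Ec /ucycle rot_cycle rot_uniq.
have c'c z : z \in c' -> (rank z <= rank v)%N.
  by move=> zc'; apply: v_max; have : z \in c by rewrite -(mem_rot i) Ec inE zc' orbT.
have {size_c} : (2 < size (v :: c'))%N by rewrite -Ec size_rot.
case: c' cyc' c'c {Ec} => // a c'; case/lastP: c' => // c' z /andP[].
rewrite /= rcons_path last_rcons => /andP[va /andP[_ zv]] /and3P[_ +_ ] rk _.
rewrite (parP a v) ?rk ?mem_head 1?adj_sym // -(parP z v) ?mem_rcons ?mem_head //.
by rewrite rk // inE mem_rcons mem_head orbT.
Qed.

(** * Encoding bits in graph streams *)

Section Instances.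
Variables (n k : nat) (s : 'I_n) (l r : 'I_k -> 'I_n).
Hypotheses (l_inj : injective l) (r_inj : injective r).
Hypotheses (lr : forall i j, l i != r j) (ls : forall i, l i != s).
Hypothesis rs : forall j, r j != s.
Implicit Types (x : {ffun 'I_k * 'I_k -> bool}) (p : 'I_k * 'I_k).

Definition bip x : seq (gitem n) :=
  [seq (l p.1, r p.2, 1%N) | p <- enum [pred p | x p]].

Lemma lr_pair_inj p q : [set l p.1; r p.2] = [set l q.1; r q.2] -> p = q.
Proof.
case: p q => i j [i' j'] /set2_inj /= [[/l_inj-> /r_inj->] //|[/eqP]].
by rewrite (negPf (lr _ _)).
Qed.

Lemma edges_bipP x e :
  reflect (exists2 p, x p & e = [set l p.1; r p.2]) (e \in edges (bip x)).
Proof.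
rewrite inE /bip -map_comp; apply: (iffP mapP) => -[p].
  by rewrite mem_enum inE => xp ->; exists p.
by move=> xp ->; exists p; rewrite ?mem_enum.
Qed.

Lemma lr_mem_bip x p : ([set l p.1; r p.2] \in edges (bip x)) = x p.
Proof.
apply/edges_bipP/idP => [[q xq /lr_pair_inj ->] //|xp]; by exists p.
Qed.

Lemma s_notin_bip x v : [set s; v] \notin edges (bip x).
Proof.
apply/edges_bipP => -[p _ /set2_inj[[E _]|[E _]]].
  by have := ls p.1; rewrite -E eqxx.
by have := rs p.2; rewrite -E eqxx.
Qed.

Lemma uniq_bip x : uniq (map (@edge_of n) (bip x)).
Proof.
rewrite /bip -map_comp map_inj_in_uniq ?enum_uniq // => p q _ _.
exact: lr_pair_inj.
Qed.

Lemma size_bip x : (size (bip x) <= k ^ 2)%N.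
Proof.
rewrite size_map -cardE; apply: leq_trans (max_card _) _.
by rewrite card_prod card_ord mulnn.
Qed.

Lemma bip_item x y : y \in bip x -> y.1.1 != y.1.2 /\ y.2 = 1%N.
Proof. by case/mapP => p _ ->; rewrite /= lr. Qed.

(** * Shortest paths *)

Definition sp_stream x p : seq (gitem n) := bip x ++ [:: (s, l p.1, 1%N)].

Lemma sp_item x p y : y \in sp_stream x p -> y.1.1 != y.1.2 /\ y.2 = 1%N.
Proof.
rewrite mem_cat inE => /orP[/bip_item //|/eqP-> /=].
by rewrite eq_sym.
Qed.

Lemma sp_simple x p m wmax : (k ^ 2 < m)%N -> (0 < wmax)%N ->
  simple_stream m wmax (sp_stream x p).
Proof.
move=> km w_gt0; split; first split.
- by rewrite size_cat addn1; apply: leq_ltn_trans (size_bip x) km.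
- by move=> y /sp_item[-> ->].
rewrite map_cat cat_uniq uniq_bip /= andbT orbF.
by have := s_notin_bip x (l p.1); rewrite inE.
Qed.

(** The only neighbour of [s] is [l p.1] and all weights are 1, so a walk of length 2 to [r p.2]
    must be [s], [l p.1], [r p.2]. *)
Lemma sp_dist x p : is_dist (sp_stream x p) s (r p.2) (Some 2%N) <-> x p.
Proof.
set A := sp_stream x p.
have A1 y : y \in A -> y.2 = 1%N by case/sp_item.
have A_gt0 y : y \in A -> (0 < y.2)%N by move/A1 ->.
have A_uniq : uniq (map (@edge_of n) A).
  by have [_] := sp_simple x p (ltnSn _) (ltn0Sn 0).
have sv v : adj (edges A) s v = (v == l p.1).
  rewrite /adj /=.
  rewrite edges_cat inE (negPf (s_notin_bip _ _)) /= inE /= inE.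
  apply/eqP/eqP => [/set2_inj /= [[]|[E _]] //|->//].
  by have := ls p.1; rewrite -E eqxx.
have lrA : adj (edges A) (l p.1) (r p.2) = x p.
  rewrite /adj /=.
  rewrite edges_cat inE lr_mem_bip inE /= inE; case: (x p) => //=.
  apply/eqP => /set2_inj /= [[E _]|[_ E]].
    by have := ls p.1; rewrite E eqxx.
  by have := rs p.2; rewrite E eqxx.
have size2 q : walk A s (r p.2) q -> (2 <= size q)%N.
  case: q => [|v [|v' q]] // [] /=.
    by move=> _ E; have := rs p.2; rewrite E eqxx.
  rewrite andbT sv => /eqP-> E.
  by have := lr p.1 p.2; rewrite E eqxx.
split=> [[[q wq lenq] _]|xp].
  have := size_le_walk_length A_gt0 wq.1; rewrite lenq.
  have := size2 _ wq; case: q wq {lenq} => [|u [|v [|]]] // [] /= + E _ _.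
  rewrite sv /= E andbT => /andP[/eqP -> lrT].
  by rewrite -lrA.
split; last first.
  move=> q wq; apply: leq_trans (size2 _ wq) _.
  exact: size_le_walk_length wq.1.
exists [:: l p.1; r p.2].
  by split=> //=; rewrite sv lrA eqxx xp.
rewrite /walk_length /= !weight_unit // !count_uniq_mem // addn0.
have -> : [set s; l p.1] \in map (@edge_of n) A.
  by have := sv (l p.1); rewrite eqxx /adj /= inE.
by move: lrA; rewrite /adj /= inE xp => ->.
Qed.

(* Every edge at [r j] except [l i -- r j] gets weight at least 2, so that
   [l i -- r j] is in a minimum spanning tree if and only if it is present. *)
Definition mst_suffix p : seq (gitem n) :=
  let heavy := [seq (u, r p.2, 1%N) | u <- enum [pred u | u \notin [:: l p.1; r p.2]]] in
  [seq (s, v, 1%N) | v <- enum [pred v | v \notin [:: s; r p.2]]] ++ heavy ++ heavy.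

Definition mst_stream x p := bip x ++ mst_suffix p.

Lemma mst_item x p y : y \in mst_stream x p -> y.1.1 != y.1.2 /\ y.2 = 1%N.
Proof.
rewrite !mem_cat orbb => /or3P[/bip_item //|/mapP[v]|/mapP[v]];
  rewrite mem_enum !inE negb_or => /andP[? ?] -> //=.
by rewrite eq_sym.
Qed.

Lemma mst_incr x p m wmax : (k ^ 2 + 3 * n <= m)%N -> (0 < wmax)%N ->
  incremental_stream m wmax (mst_stream x p).
Proof.
move=> km w_gt0; split; last by move=> y /mst_item[-> ->].
apply: leq_trans km; rewrite size_cat leq_add ?size_bip // !size_cat !size_map -!cardE.
have le_n (P : pred 'I_n) : (#|P| <= n)%N by rewrite -[leqRHS]card_ord max_card.
by rewrite !mulSn mul0n addn0 !leq_add.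
Qed.

(** The list [heavy] occurs twice in the suffix, and the weights of repeated occurrences add up;
    this is where incremental weights enter. *)
Lemma heavy_weight x p u : u != l p.1 -> u != r p.2 ->
  (2 <= weight (mst_stream x p) [set u; r p.2])%N.
Proof.
move=> ul ur; rewrite weight_unit; last by move=> y /mst_item[].
rewrite !map_cat !count_cat.
set c := count_mem _ (map (@edge_of n) [seq (_, r p.2, 1%N) | _ <- _]).
have : (0 < c)%N; last by lia.
rewrite -has_count; apply/hasP; exists [set u; r p.2]; last by rewrite /= eqxx.
rewrite -map_comp; apply/mapP; exists u => //.
by rewrite mem_enum !inE negb_or ul ur.
Qed.

Lemma star_edge x p v : v != s -> v != r p.2 ->
  [set s; v] \in edges (mst_stream x p).
Proof.
move=> vs vr; rewrite !edges_cat !inE; apply/orP; right; apply/orP; left.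
rewrite -map_comp; apply/mapP; exists v => //.
by rewrite mem_enum !inE negb_or vs vr.
Qed.

Lemma mst_connected x p : connected (edges (mst_stream x p)).
Proof.
set T := edges _; have symT := sym_connect_sym (@adj_sym _ T).
suff cs v : connect (adj T) s v.
  by move=> u v; apply: connect_trans (cs v); rewrite symT.
have [-> //|vs] := eqVneq v s.
apply: connect1; rewrite /adj /=.
have [->|vr] := eqVneq v (r p.2); last exact: star_edge.
(* The vertex [r p.2] is left out of the star, but [s] reaches it by a heavy edge. *)
rewrite /T !edges_cat !inE; apply/orP; right; apply/orP; right; apply/orP; left.
rewrite -map_comp; apply/mapP; exists s => //.
by rewrite mem_enum !inE negb_or eq_sym ls eq_sym rs.
Qed.

(** Such an edge is never heavy, and it can occur in only one of the bipartite part and the star,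
    each of which lists an edge at most once. *)
Lemma edge_weight1 x p e : e = [set l p.1; r p.2] \/
    (exists v, [/\ v != s, v != r p.2 & e = [set s; v]]) ->
  (weight (mst_stream x p) e <= 1)%N.
Proof.
move=> He; rewrite weight_unit; last by move=> y /mst_item[].
rewrite !map_cat !count_cat.
set c := count_mem _ (map (@edge_of n) [seq (_, r p.2, 1%N) | _ <- _]).
have c0 : c = 0%N.
  apply/eqP; rewrite -leqn0 leqNgt -has_count -map_comp; apply/hasPn => d /mapP[u].
  rewrite mem_enum !inE negb_or => /andP[ul ur] ->.
  rewrite /edge_of /=; apply/eqP => E.
  case: He => [|[v [vs vr]]]; rewrite -E => /set2_inj[[E1 E2]|[E1 E2]].
  - by rewrite E1 eqxx in ul.
  - by rewrite E1 eqxx in ur.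
  - by rewrite E2 eqxx in vr.
  - by have := rs p.2; rewrite E2 eqxx.
have star_uniq : uniq (map (@edge_of n)
    [seq (s, v, 1%N) | v <- enum [pred v | v \notin [:: s; r p.2]]]).
  rewrite -map_comp map_inj_in_uniq ?enum_uniq // => u v _ _.
  by rewrite /edge_of /= => /set2_inj[[]|[-> ->]].
rewrite c0 !addn0 !count_uniq_mem ?uniq_bip //.
case: He => [->|[v [vs vr ->]]]; last first.
  by have := s_notin_bip x v; rewrite inE => /negPf->; rewrite leq_b1.
rewrite [X in (_ + X)%N](_ : _ = 0%N) ?addn0 ?leq_b1 //.
apply/eqP; rewrite eqb0 -map_comp; apply/mapP => -[v _ /set2_inj /=[[E _]|[_ E]]].
  by have := ls p.1; rewrite E eqxx.
by have := rs p.2; rewrite E eqxx.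
Qed.

(** Parent map of the tree rooted at [s] in which [r p.2] hangs below [l p.1] and every other vertex
    hangs directly below [s]. *)
Definition star_parent p v : 'I_n := if v == r p.2 then l p.1 else s.

Definition star_tree p : {set {set 'I_n}} :=
  [set [set star_parent p v; v] | v in [pred v | v != s]].

Lemma star_treeP p e : e \in star_tree p -> e = [set l p.1; r p.2] \/
    (exists v, [/\ v != s, v != r p.2 & e = [set s; v]]).
Proof.
case/imsetP => v vs ->; rewrite /star_parent.
by case: eqVneq => [->|vr]; [left | right; exists v].
Qed.

Lemma star_tree_spanning x p : x p -> spanning_tree (mst_stream x p) (star_tree p).
Proof.
move=> xp; split.
- apply/subsetP => e /star_treeP[->|[v [vs vr ->]]]; last exact: star_edge.
  by rewrite edges_cat inE lr_mem_bip xp.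
- have symT := sym_connect_sym (@adj_sym _ (star_tree p)).
  have par v : v != s -> connect (adj (star_tree p)) (star_parent p v) v.
    by move=> vs; apply: connect1; apply/imsetP; exists v.
  suff cs v : connect (adj (star_tree p)) s v.
    by move=> u v; apply: connect_trans (cs v); rewrite symT.
  have [-> //|vs] := eqVneq v s.
  have := par v vs; rewrite /star_parent; case: ifP => // _.
  apply: connect_trans; have := par _ (ls p.1).
  by rewrite /star_parent (negPf (lr _ _)).
(* The rank is the depth in this tree: 0 at [s], 2 at [r p.2], 1 elsewhere. *)
apply: (@parent_acyclic _ _ (star_parent p)
  (fun v => if v == r p.2 then 2 else (v != s))%N) => u v.
move=> /imsetP[z]; rewrite inE => zs /set2_inj[[-> ->] //|[-> ->]].
rewrite /star_parent.
case: (eqVneq z (r p.2)) => [_|_]; first by rewrite (negPf (lr _ _)) ls.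
by rewrite [s == r _]eq_sym (negPf (rs _)) eqxx zs.
Qed.

(** If the bit is one, [star_tree p] costs at most [n.-1]. A spanning tree without the edge has at
    least [n - 1] edges and reaches [r p.2] through a heavy one, so it costs at least [n]. *)
Lemma mst_edge x p T : min_spanning_tree (mst_stream x p) T ->
  ([set l p.1; r p.2] \in T) = x p.
Proof.
set A := mst_stream x p => -[[TA conT acT] minT].
apply/idP/idP => [/(subsetP TA)|xp].
  rewrite !edges_cat setUid !inE => /or3P[|/mapP[y /mapP[v]]|/mapP[y /mapP[v]]].
  - by have := lr_mem_bip x p; rewrite inE => ->.
  - rewrite mem_enum !inE negb_or => /andP[vs vr] -> /set2_inj[[E _]|[_ E]].
      by have := ls p.1; rewrite E eqxx.
    by have := rs p.2; rewrite E eqxx.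
  rewrite mem_enum !inE negb_or => /andP[vl vr] -> /set2_inj[[E _]|[E _]] /=.
    by rewrite E eqxx in vl.
  by have := lr p.1 p.2; rewrite E eqxx.
apply: contrapT => /negP lrT.
have := minT _ (star_tree_spanning xp).
have star_le : (\sum_(e in star_tree p) weight A e <= n.-1)%N.
  apply: (@leq_trans (\sum_(e in star_tree p) 1)).
    by apply: leq_sum => e /star_treeP; apply: edge_weight1.
  rewrite sum1_card; apply: leq_trans (leq_imset_card _ _) _.
  by have := cardC1 s; rewrite card_ord => <-.
(* The first edge on a path from [r p.2] to [s]; it is not a loop because no stream item is. *)
have [u uT ur] : exists2 u, [set u; r p.2] \in T & u != r p.2.
  have /connectP[[|u q] /= pq E] := conT (r p.2) s.
    by have := rs p.2; rewrite -E eqxx.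
  move: pq => /andP[ru _]; exists u; first by rewrite setUC.
  have /edgesP[y yA Ey] := subsetP TA _ ru.
  have [yne _] := mst_item yA; apply: contra_neq yne => ur.
  by move: Ey; rewrite ur => /set2_inj[[<- <-]|[<- <-]].
have ul : u != l p.1 by apply: contraNneq lrT => <-.
have : (#|T| < \sum_(e in T) weight A e)%N.
  rewrite -sum1_card (bigD1 _ uT) [ltnRHS](bigD1 _ uT) /=.
  rewrite -addSn leq_add ?heavy_weight //; apply: leq_sum => e /andP[eT _].
  by apply: weight_gt0; [move=> y /mst_item[_ ->] | apply: subsetP TA _ _].
have := connected_card conT; lia.
Qed.

End Instances.

(** * From INDEX to the three graph problems *)

Lemma bipartition_avoiding n k (s : 'I_n) : (2 * k < n)%N ->
  exists l r : 'I_k -> 'I_n,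
    [/\ injective l, injective r, forall i j, l i != r j,
        forall i, l i != s & forall j, r j != s].
Proof.
move=> kn; pose V := enum (predC1 s).
have sizeV : size V = n.-1 by rewrite -cardE cardC1 card_ord.
have ltl (i : 'I_k) : (i < size V)%N by have := ltn_ord i; lia.
have ltr (i : 'I_k) : (k + i < size V)%N by have := ltn_ord i; lia.
have V_uniq : uniq V by apply: enum_uniq.
have Vs i : (i < size V)%N -> nth s V i != s.
  by move=> /(mem_nth s); rewrite mem_enum.
exists (fun i => nth s V i), (fun j => nth s V (k + j)); split.
- by move=> i j /eqP; rewrite nth_uniq // => /eqP /val_inj.
- by move=> i j /eqP; rewrite nth_uniq // eqn_add2l => /eqP /val_inj.
- by move=> i j; rewrite nth_uniq //; have := ltn_ord i; lia.
- by move=> i; apply: Vs.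
- by move=> j; apply: Vs.
Qed.

(** INDEX on [k * k] bits gives [14 * k ^ 2 <= 150 * P + 30] for the product [P]. Since
    [n <= 2 * k + 2] and [k >= 49], the lower-order terms are absorbed and [n ^ 2 <= 100 * P]. *)
Lemma product_from_index (item osym : Type) (X : problem item osym) n k
    (pre : {ffun 'I_k * 'I_k -> bool} -> seq item) (suf : 'I_k * 'I_k -> seq item)
    (D : 'I_k * 'I_k -> seq osym -> Prop) :
  (100 <= n)%N -> k = n.-1./2 ->
  (forall x p, admissible X (pre x ++ suf p)) ->
  (forall x p o, correct X (pre x ++ suf p) o -> (D p o <-> x p)) ->
  requires_product 100^-1 n X.
Proof.
move=> n_ge kE adm DP R b w h V b_gt0 VP hH.
have := index_lower_bound b_gt0 VP hH adm DP.
rewrite card_prod card_ord.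
set P := (_ * (w * b))%N => bound.
have c_gt0 : (0 : rat) < 100%:R by rewrite ltr0n.
rewrite (ler_pdivrMl _ _ c_gt0) -natrM ler_nat.
have [n2k k_ge] : (n <= 2 * k + 2)%N /\ (49 <= k)%N by split; lia.
have n2_le : (n * n <= (2 * k + 2) * (2 * k + 2))%N by apply: leq_mul.
have k2_ge : (49 * k <= k * k)%N by rewrite leq_mul2r k_ge orbT.
rewrite -mulnn; clear -bound k2_ge k_ge n2_le; lia.
Qed.

Theorem theorem7 :
  exists (c : rat) (n0 : nat), 0 < c /\
    forall n m wmax : nat, (n0 <= n)%N -> (n ^ 2 <= m)%N -> (0 < wmax)%N ->
      [/\ forall s : 'I_n, requires_product c n (sssp m wmax s),
          requires_product c n (@apsp n m wmax)
        & requires_product c n (@mst_incremental n m wmax)].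
Proof.
exists 100^-1, 100%N; split=> [|n m wmax n_ge nm w_gt0].
  by rewrite invr_gt0 ltr0n.
pose k := n.-1./2; have kn : (2 * k < n)%N by rewrite /k; lia.
have s0 : 'I_n by apply: (@Ordinal n 0); lia.
(* Room for at most [k ^ 2] items from Alice, one star and two copies of the heavy list; it suffices
   that [4 * k ^ 2 <= n ^ 2] and [100 * n <= n ^ 2]. *)
have km : (k ^ 2 + 3 * n <= m)%N.
  have k2_le : (2 * k * (2 * k) <= n * n)%N by apply: leq_mul; apply: ltnW.
  have n2_ge : (100 * n <= n * n)%N by rewrite leq_mul2r n_ge orbT.
  apply: leq_trans nm; rewrite -!mulnn; clear -k2_le n2_ge; lia.
have km' : (k ^ 2 < m)%N by by apply: leq_trans km; rewrite -addn1 leq_add2l; lia.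
split=> [s||].
- have [l [r [l_inj r_inj lr ls rs]]] := bipartition_avoiding s kn.
  apply: (product_from_index (pre := bip l r) (suf := fun p => [:: (s, l p.1, 1%N)])
    (D := fun p o => (r p.2, Some 2%N) \in o)) => // x p; first exact: sp_simple.
  by move=> o /= ->; apply: sp_dist.
(* All-pairs distances contain those from the fixed source [s0], so the same streams serve. *)
- have [l [r [l_inj r_inj lr ls rs]]] := bipartition_avoiding s0 kn.
  apply: (product_from_index (pre := bip l r) (suf := fun p => [:: (s0, l p.1, 1%N)])
    (D := fun p o => (s0, r p.2, Some 2%N) \in o)) => // x p; first exact: sp_simple.
  by move=> o /= ->; apply: sp_dist.
have [l [r [l_inj r_inj lr ls rs]]] := bipartition_avoiding s0 kn.
apply: (product_from_index (pre := bip l r) (suf := mst_suffix s0 l r)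
  (D := fun p o => [set l p.1; r p.2] \in [set:: o])) => // x p.
  by split; [apply: mst_incr | apply: mst_connected].
by move=> o /= /mst_edge ->.
Qed.
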